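(* Let $B=[b_1,\ldots,b_n]\in\mathbb{C}[x_1,\ldots,x_m]^n$, let $\mathbf{z}_s=[z_{s,1},\ldots,z_{s,m}]\in\mathbb{C}^m$ for $s=1,\ldots,k$, and let $$C_i=\{\mathbf{z}_i+\vec{\delta}_{i,1}\varepsilon,\ldots,\mathbf{z}_i+\vec{\delta}_{i,n_i}\varepsilon\},\qquad i=1,\ldots,k,$$ be clusters with $\sum_{i=1}^kn_i=n$, where $\varepsilon$ is a parameter and $\vec{\delta}_{i,j}=[\delta_{i,j,1},\ldots,\delta_{i,j,m}]\in\mathbb{C}^m$ with $|\delta_{i,j,r}|<1$ for all $i,j,r$. Let $R$ be the matrix of traces associated to $C_1\cup\cdots\cup C_k$ and $B$. Let $P$ be the (row) permutation matrix, with permutation $\sigma$, produced by $k$ steps of Gaussian elimination with complete pivoting on $R$, where $B$ is ordered so that the column permutation is the identity, and assume that $P\,R|_{\varepsilon=0}$ has rank $k$ and is regular. Let $M'_{x_1},\ldots,M'_{x_m}$ be the approximate multiplication matrices of the radical of $C_1\cup\cdots\cup C_k$ with respect to $[b_1,\ldots,b_k]$ (defined in the context). For $i=1,\ldots,k$ let $\vec{\xi}_i=[\xi_{i,1},\ldots,\xi_{i,m}]$ with $$\xi_{i,j}:=z_{i,j}+\frac{\sum_{r=1}^{n_i}\delta_{i,r,j}}{n_i}\,\varepsilon,\qquad j=1,\ldots,m,$$ and let $\mathbf{e}_{\vec{\xi}_i}:=[b_s(\vec{\xi}_i)]_{s=1}^k$. Then for all $i=1,\ldots,k$ and $j=1,\ldots,m$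 $$M'_{x_j}\,\mathbf{e}_{\vec{\xi}_i}\equiv\xi_{i,j}\,\mathbf{e}_{\vec{\xi}_i}\mod\varepsilon^2 .$$ Thus the vectors $\{\mathbf{e}_{\vec{\xi}_i}\}_{i=1}^k$ form a common eigensystem for the approximate multiplication matrices $M'_{x_1},\ldots,M'_{x_m}$ modulo $\varepsilon^2$, which also implies that these matrices are pairwise commuting modulo $\varepsilon^2$, i.e. the entries of the commutators $M'_{x_i}M'_{x_j}-M'_{x_j}M'_{x_i}$ are all divisible by $\varepsilon^2$ (in $\mathbb{C}[[\varepsilon]]$).
   Context: For a polynomial $g\in\mathbb{C}[x_1,\ldots,x_m]$ put $Tr(g):=\sum_{s=1}^k\sum_{t=1}^{n_s}g(\mathbf{z}_s+\vec{\delta}_{s,t}\varepsilon)\in\mathbb{C}[\varepsilon]$ (the trace of multiplication by $g$ for the points of the clusters). The matrix of traces associated to $C_1\cup\cdots\cup C_k$ and $B$ is $R=[Tr(b_ib_j)]_{i,j=1}^n$. Regular Gaussian elimination always uses the $(i,i)$ entry as pivot at step $i$. A matrix $M$ is regular if, for $r:=\mathrm{rank}(M)$, the first $r$ steps of regular Gaussian elimination on $M$ do not encounter zero pivots. Gaussian elimination with complete pivoting (GECP): at step $i$, rows and columns of index $\geq i$ are permuted so that the $(i,i)$ entry of the current matrix has maximal absolute value among the entries with both indices $\geq i$ (for $R$, absolute values are compared for sufficiently small $\varepsilon>0$). The permutation matrices $P,Q$ it produces are such that regular Gaussian elimination on $P\,R\,Q$ works as GECP; by renaming the elements of $B$ one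 assumes $Q=\mathrm{id}$. Put $\tilde R:=P\,R$, whose rows and columns correspond to $[b_{\sigma(1)},\ldots,b_{\sigma(n)}]$ and $[b_1,\ldots,b_n]$, i.e. $\tilde R_{s,t}=Tr(b_{\sigma(s)}b_t)$. Let $\tilde R^{(k)}$ be the $k\times k$ principal (top left) submatrix of $\tilde R$. For $i=1,\ldots,m$, $j=1,\ldots,k$ let $\mathbf{r}_{i,j}:=[Tr(x_ib_jb_{\sigma(1)}),\ldots,Tr(x_ib_jb_{\sigma(k)})]^T$ and let $\mathbf{v}_{i,j}\in\mathbb{C}(\varepsilon)^k$ be the solution of the linear system $\tilde R^{(k)}\mathbf{v}_{i,j}=\mathbf{r}_{i,j}$. The approximate multiplication matrices of the radical with respect to $[b_1,\ldots,b_k]$ are the matrices $M'_{x_1},\ldots,M'_{x_m}\in\mathbb{C}(\varepsilon)^{k\times k}$ with $[M'_{x_i}]_{j,s}:=[\mathbf{v}_{i,j}]_s$ for $i=1,\ldots,m$ and $j,s=1,\ldots,k$. The coordinates of the $\mathbf{v}_{i,j}$ are rational functions of $\varepsilon$ with denominators nonzero at $\varepsilon=0$ and are identified with their Taylor expansions in $\mathbb{C}[[\varepsilon]]$; congruences modulo $\varepsilon^2$ are in $\mathbb{C}[[\varepsilon]]$, entrywise. *)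

(* Defs.v *)
From HB Require Import structures.
From mathcomp Require Import all_boot all_order all_fingroup all_algebra.
From mathcomp Require Import generic_quotient fraction.
From mathcomp Require Import reals complex mpoly.

Set Implicit Arguments.
Unset Strict Implicit.
Unset Printing Implicit Defensive.

Import GRing.Theory Num.Theory.
Local Open Scope ring_scope.
Local Open Scope quotient_scope.
Local Open Scope complex_scope.

Notation "x %:F" := (@FracField.tofrac _ x) : ring_scope.

(* The parameter epsilon is the variable 'X of {poly C}; C[eps] embeds in
   C(eps) = {fraction {poly C}} by _%:F. *)

Section GaussianElimination.
Variables (K : fieldType) (n : nat).

(* Rows and columns are numbered from 0. With a zero pivot the step does
   nothing, because M i i = 0 gives (M i i)^-1 = 0. *)
Definition gauss_step (i : 'I_n) (M : 'M[K]_n) : 'M[K]_n :=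
  \matrix_(s, t) if (i < s)%N then M s t - M s i / M i i * M i t else M s t.

Definition gauss_iter (r : nat) (M : 'M[K]_n) : 'M[K]_n :=
  foldl (fun A i => gauss_step i A) M (take r (enum 'I_n)).

Definition regular_mx (M : 'M[K]_n) : Prop :=
  forall i : 'I_n, (i < \rank M)%N -> gauss_iter i M i i != 0.

End GaussianElimination.

Section PowerSeries.
Variable K : fieldType.

(* A formal power series is its sequence of coefficients. *)
Definition fps := nat -> K.

Definition fps_of_poly (p : {poly K}) : fps := fun n => p`_n.

Definition fps_mul (s t : fps) : fps :=
  fun n => \sum_(i < n.+1) s i * t (n - i)%N.

(* s is the expansion at eps = 0 of the rational function f, which has a
   denominator that does not vanish at 0. *)
Definition has_taylor (f : {fraction {poly K}}) (s : fps) : Prop :=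
  exists p q : {poly K},
    [/\ q.[0] != 0, f = p%:F / q%:F
      & forall n, fps_mul (fps_of_poly q) s n = p`_n].

Definition eqmod_eps2 (f g : {fraction {poly K}}) : Prop :=
  exists s t u : fps,
    [/\ has_taylor f s, has_taylor g t
      & forall n, s n - t n = fps_mul (fps_of_poly 'X^2) u n].

Definition mx_has_taylor p q (A : 'M[{fraction {poly K}}]_(p, q)) : Prop :=
  forall i j, exists s, has_taylor (A i j) s.

Definition mx_eqmod_eps2 p q (A B : 'M[{fraction {poly K}}]_(p, q)) : Prop :=
  forall i j, eqmod_eps2 (A i j) (B i j).

(* The k vectors e_i form a basis of the free module (C[[eps]]/(eps^2))^k:
   the matrix with columns e_i is invertible modulo eps^2. *)
Definition basis_mod_eps2 k (e : 'I_k -> 'cV[{fraction {poly K}}]_k) : Prop :=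
  let E := \matrix_(s < k, i < k) e i s ord0 in
  exists W : 'M[{fraction {poly K}}]_k,
    [/\ mx_has_taylor W, mx_eqmod_eps2 (E *m W) 1%:M
      & mx_eqmod_eps2 (W *m E) 1%:M].

End PowerSeries.

Section CompletePivoting.
Variables (R : realType) (n : nat).

(* For each f, the chosen representative has a nonzero denominator at every
   small enough x <> 0, where the value depends only on f. *)
Definition frac_eval (f : {fraction {poly R[i]}}) (x : R[i]) : R[i] :=
  (\n_(repr f)).[x] / (\d_(repr f)).[x].

Definition abs_le_near0 (f g : {fraction {poly R[i]}}) : Prop :=
  exists2 e0 : R, 0 < e0 &
    forall e : R, 0 < e -> e < e0 ->
      `|frac_eval f e%:C| <= `|frac_eval g e%:C|.

(* gecp A0 r sigma tau A : r steps of complete pivoting on A0 can produce the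
   matrix A, with A0 (sigma s) (tau t) the entry of A0 that is moved to
   position (s, t). Ties between maximal entries may be broken in any way. *)
Inductive gecp (A0 : 'M[{fraction {poly R[i]}}]_n) :
    nat -> 'S_n -> 'S_n -> 'M[{fraction {poly R[i]}}]_n -> Prop :=
| gecp_start : gecp A0 0 1%g 1%g A0
| gecp_next (i : 'I_n) (sigma tau s t : 'S_n) (A : 'M_n) :
    gecp A0 i sigma tau A ->
    (forall j : 'I_n, (j < i)%N -> s j = j /\ t j = j) ->
    let A' := row_perm s (col_perm t A) in
    A' i i != 0 ->
    (forall p q : 'I_n, (i <= p)%N -> (i <= q)%N ->
       abs_le_near0 (A' p q) (A' i i)) ->
    gecp A0 i.+1 (s * sigma)%g (t * tau)%g (gauss_step i A').

End CompletePivoting.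

Section Clusters.
Variables (R : realType) (m k n : nat).
Variable ns : 'I_k -> nat.
Variable z : 'I_k -> 'I_m -> R[i].
Variable delta : forall s : 'I_k, 'I_(ns s) -> 'I_m -> R[i].
Variable b : 'I_n -> {mpoly R[i][m]}.

Definition eval_eps (g : {mpoly R[i][m]}) (v : 'I_m -> {poly R[i]}) :
  {poly R[i]} := mmap (@polyC R[i]) v g.

Definition cluster_point (s : 'I_k) (t : 'I_(ns s)) : 'I_m -> {poly R[i]} :=
  fun j => (z s j)%:P + delta t j *: 'X.

Definition Tr (g : {mpoly R[i][m]}) : {poly R[i]} :=
  \sum_(s < k) \sum_(t < ns s) eval_eps g (cluster_point t).

Definition trace_mx : 'M[{poly R[i]}]_n := \matrix_(i, j) Tr (b i * b j).

Definition xi (i : 'I_k) : 'I_m -> {poly R[i]} :=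
  fun j => (z i j)%:P + ((\sum_(r < ns i) delta r j) / (ns i)%:R) *: 'X.

Variables (hkn : (k <= n)%N) (sigma : 'S_n).

(* The index of b_j in b_1, ..., b_n, for j <= k. *)
Let idx (j : 'I_k) : 'I_n := widen_ord hkn j.

(* The top left k x k submatrix of P R. *)
Definition lead_trace_mx : 'M[{fraction {poly R[i]}}]_k :=
  map_mx (@FracField.tofrac _) (mxsub idx idx (row_perm sigma trace_mx)).

Definition trace_rhs (i : 'I_m) (j : 'I_k) : 'cV[{fraction {poly R[i]}}]_k :=
  \col_s (Tr ('X_i * b (idx j) * b (sigma (idx s))))%:F.

(* This is the solution of lead_trace_mx *m v = trace_rhs i j when
   lead_trace_mx is invertible. *)
Definition trace_sol (i : 'I_m) (j : 'I_k) : 'cV[{fraction {poly R[i]}}]_k :=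
  invmx lead_trace_mx *m trace_rhs i j.

Definition approx_mult_mx (i : 'I_m) : 'M[{fraction {poly R[i]}}]_k :=
  \matrix_(j, s) trace_sol i j s ord0.

Definition e_xi (i : 'I_k) : 'cV[{fraction {poly R[i]}}]_k :=
  \col_s (eval_eps (b (idx s)) (xi i))%:F.

End Clusters.

Lemma leq_clusters (k n : nat) (ns : 'I_k -> nat) :
  (forall s, (0 < ns s)%N) -> (\sum_(s < k) ns s)%N = n -> (k <= n)%N.
Proof.
move=> ns_gt0 <-; rewrite -[X in (X <= _)%N]card_ord -sum1_card.
by apply: leq_sum => s _.
Qed.

(* Main.v *)
(** Averaging over a cluster kills everything but the barycentre at first order:
    Tr g = sum_s n_s g(xi_s) mod eps^2. Hence, with V = [b_t(xi_s)], the leading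
    block L of P R and the right-hand sides S_j satisfy L = U V and
    S_j = U D_j V mod eps^2, where U has entries n_s b_(sigma l)(xi_s) and D_j is
    the diagonal matrix of the xi_(s,j). Regularity makes L, hence U and V,
    invertible at eps = 0, so L^-1 S_j = V^-1 D_j V mod eps^2; the transposes
    M'_j thus have the columns of V^T as common eigenvectors. *)

Require Import Defs.
From mathcomp Require Import all_boot all_order all_fingroup all_algebra.
From mathcomp Require Import generic_quotient fraction.
From mathcomp Require Import reals complex mpoly ring.

Set Implicit Arguments.
Unset Strict Implicit.
Unset Printing Implicit Defensive.

Import GRing.Theory Num.Theory.
Local Open Scope ring_scope.
Local Open Scope complex_scope.

(** * Gaussian elimination and the leading minor of a regular matrix *)

Section Gauss.
Variables (K : fieldType) (n : nat).
Implicit Types M : 'M[K]_n.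

Lemma gauss_iterS M (i : 'I_n) :
  gauss_iter i.+1 M = gauss_step i (gauss_iter i M).
Proof.
rewrite /gauss_iter (take_nth i) ?size_enum_ord // foldl_rcons.
by rewrite nth_ord_enum.
Qed.

Lemma gauss_iter_row M r (s t : 'I_n) :
  (s <= r)%N -> (r <= n)%N -> gauss_iter r M s t = gauss_iter s M s t.
Proof.
elim: r => [|r IHr]; first by rewrite leqn0 => /eqP->.
rewrite leq_eqVlt => /predU1P[-> //|]; rewrite ltnS => le_sr lt_rn.
rewrite -[r in LHS]/(nat_of_ord (Ordinal lt_rn)) gauss_iterS mxE /= ltnNge le_sr /=.
by rewrite IHr // ltnW.
Qed.

(** Step t clears column t below its pivot; a later step r only subtracts multiples of row r, whose
    entry in column t is already 0. *)
Lemma gauss_iter_col0 M r (s t : 'I_n) :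
    (forall i : 'I_n, (i < r)%N -> gauss_iter i M i i != 0) ->
  (r <= n)%N -> (t < r)%N -> (t < s)%N -> gauss_iter r M s t = 0.
Proof.
elim: r s => // r IHr s piv lt_rn lt_tr lt_ts.
have piv' (i : 'I_n) : (i < r)%N -> gauss_iter i M i i != 0.
  by move=> lt_ir; apply/piv/leqW.
rewrite -[r]/(nat_of_ord (Ordinal lt_rn)) gauss_iterS mxE /=.
move: lt_tr; rewrite ltnS leq_eqVlt => /predU1P[tr|lt_tr].
  have -> : t = Ordinal lt_rn by apply: val_inj.
  have -> : (r < s)%N by rewrite -tr.
  by rewrite divfK ?subrr ?(piv (Ordinal lt_rn)) /=.
have IH (s' : 'I_n) : (t < s')%N -> gauss_iter r M s' t = 0.
  by move=> lt_ts'; apply: IHr => //; apply: ltnW.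
by rewrite !IH // mulr0 subrr if_same.
Qed.

Lemma gauss_step_trig (i : 'I_n) M :
  exists2 T : 'M[K]_n, is_trig_mx T & gauss_step i M = T *m M.
Proof.
(* The multipliers sit in column [i]. With a zero pivot they are all 0, in agreement with
   [gauss_step]. *)
exists (1%:M - \matrix_(s, t) (if (i < s)%N && (t == i) then M s i / M i i else 0)).
  apply/is_trig_mxP => s t lt_st; rewrite !mxE -val_eqE ltn_eqF //= sub0r.
  case: ifP => [/andP[lt_is /eqP ti]|]; last by rewrite oppr0.
  by rewrite ti ltnNge ltnW in lt_st.
apply/matrixP => s t; rewrite mulmxBl mul1mx !mxE.
rewrite (bigD1 i) //= big1 => [|j /negPf ne_ji]; last by rewrite mxE ne_ji andbF mul0r.
by rewrite mxE eqxx andbT addr0; case: ifP; rewrite // mul0r subr0.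
Qed.

Lemma trig_mulmx (S T : 'M[K]_n) :
  is_trig_mx S -> is_trig_mx T -> is_trig_mx (S *m T).
Proof.
move=> /is_trig_mxP Str /is_trig_mxP Ttr; apply/is_trig_mxP => i j lt_ij.
rewrite mxE big1 // => l _; case: (ltnP i l) => [/Str->|le_li]; first by rewrite mul0r.
by rewrite Ttr ?mulr0 // (leq_ltn_trans le_li).
Qed.

Lemma gauss_iter_trig r M :
  exists2 T : 'M[K]_n, is_trig_mx T & gauss_iter r M = T *m M.
Proof.
rewrite /gauss_iter; elim: (take r _) M => [|i s IHs] M /=.
  by exists 1%:M; rewrite ?mul1mx ?scalar_mx_is_trig.
have [T Ttr ->] := IHs (gauss_step i M); have [S Str ->] := gauss_step_trig i M.
by exists (T *m S); rewrite ?mulmxA ?trig_mulmx.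
Qed.

(** The first k rows of T vanish from column k on, so the lower rows of M do not contribute to the
    block. *)
Lemma mxsub_trig_mul k (le_kn : (k <= n)%N) (T M : 'M[K]_n) :
    is_trig_mx T ->
  let idx := widen_ord le_kn in
  mxsub idx idx (T *m M) = mxsub idx idx T *m mxsub idx idx M.
Proof.
move=> /is_trig_mxP Ttr idx; apply/matrixP => i j; rewrite !mxE.
rewrite (bigID (fun l : 'I_n => (l < k)%N)) /= addrC big1 ?add0r => [|l]; last first.
  by rewrite -leqNgt => le_kl; rewrite Ttr ?mul0r // (leq_trans (ltn_ord i)).
rewrite (big_ord_narrow le_kn); by apply: eq_bigr => l _; rewrite !mxE.
Qed.

(** After k steps the leading block is upper triangular with nonzero pivots on its diagonal.
    Elimination multiplies on the left by a lower triangular matrix, so the leading block of M is a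
    factor of that block. *)
Lemma regular_lead_det k (le_kn : (k <= n)%N) M :
    regular_mx M -> \rank M = k ->
  \det (mxsub (widen_ord le_kn) (widen_ord le_kn) M) != 0.
Proof.
move=> reg rkM; pose idx := widen_ord le_kn; rewrite -/idx.
have [T Ttr defG] := gauss_iter_trig k M.
have piv (i : 'I_n) : (i < k)%N -> gauss_iter i M i i != 0.
  by move=> lt_ik; apply: reg; rewrite rkM.
have: \det (mxsub idx idx (gauss_iter k M)) != 0.
  rewrite -det_tr det_trig; last first.
    by apply/is_trig_mxP => i j lt_ij; rewrite !mxE gauss_iter_col0 //=.
  (* Row i is final after i steps, so this diagonal entry is the pivot of step i. *)
  apply/prodf_neq0 => i _; rewrite !mxE gauss_iter_row //=; last exact: ltnW.
  by apply: (piv (idx i)) => /=.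
by rewrite defG mxsub_trig_mul // det_mulmx mulf_eq0 negb_or => /andP[].
Qed.

End Gauss.

(** * Taylor expansions of rational functions by long division *)

Section Taylor.
Variable K : fieldType.
Implicit Types p q a : {poly K}.

(* Long division of p by q in K[[eps]]: p = s_0 q + eps p_1 with s_0 := p(0)/q(0)
   and p_1 := taylor_rest q p, whose expansion gives the next coefficients. *)
Definition taylor_rest q p := drop_poly 1 (p - (p`_0 / q`_0) *: q).

Definition taylor q p : fps K := fun n => (iter n (taylor_rest q) p)`_0 / q`_0.

Lemma taylorS q p n : taylor q p n.+1 = taylor q (taylor_rest q p) n.
Proof. by rewrite /taylor iterSr. Qed.

Lemma taylorP q p n :
  q.[0] != 0 -> fps_mul (fps_of_poly q) (taylor q p) n = p`_n.
Proof.
rewrite horner_coef0 => q0; rewrite /fps_mul /fps_of_poly.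
elim: n p => [|n IHn] p; first by rewrite big_ord1 subn0 /taylor mulrC divfK.
(* The last summand is q_(n+1) s_0; the others convolve q with the expansion of
   [taylor_rest q p]. *)
rewrite big_ord_recr /= subnn.
under eq_bigr => i _ do rewrite subSn -1?ltnS // taylorS.
rewrite IHn coef_drop_poly addn1 !coefE /taylor /=.
by rewrite [q`_n.+1 * _]mulrC subrK.
Qed.

Lemma taylor_has_taylor q p : q.[0] != 0 -> has_taylor (p%:F / q%:F) (taylor q p).
Proof. by move=> q0; exists p, q; split=> // n; apply: taylorP. Qed.

Lemma taylorD q p a n : taylor q (p + a) n = taylor q p n + taylor q a n.
Proof.
elim: n p a => [|n IHn] p a; first by rewrite /taylor /= coefD mulrDl.
rewrite !taylorS -IHn; congr (taylor q _ n).
by rewrite /taylor_rest -linearD coefD mulrDl scalerDl opprD addrACA.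
Qed.

Lemma taylorMX q a n : taylor q ('X * a) n = if n is n'.+1 then taylor q a n' else 0.
Proof.
case: n => [|n]; first by rewrite /taylor coefXM mul0r.
rewrite taylorS /taylor_rest coefXM mul0r scale0r subr0.
by congr (taylor q _ n); apply/polyP => i; rewrite coef_drop_poly addn1 coefXM.
Qed.

Lemma eqmod_eps2_div q p1 p2 a : q.[0] != 0 ->
  p1 = p2 + 'X^2 * a -> eqmod_eps2 (p1%:F / q%:F) (p2%:F / q%:F).
Proof.
(* The expansions differ by that of ['X^2 * a] over q, which is the expansion of a/q shifted by two
   places. *)
move=> q0 ->; exists (taylor q (p2 + 'X^2 * a)), (taylor q p2), (taylor q a).
split; try exact: taylor_has_taylor.
move=> n; rewrite taylorD addrC addKr.
have -> : 'X^2 * a = 'X * ('X * a) by rewrite mulrA.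
rewrite taylorMX /fps_mul /fps_of_poly.
case: n => [|[|n]]; rewrite ?taylorMX.
- by rewrite big_ord1 coefXn mul0r.
- by rewrite big_ord_recr big_ord1 /= !coefXn !mul0r addr0.
rewrite 3!big_ord_recl !coefXn /= !mul0r !add0r mul1r subn2 big1 ?addr0 //.
by move=> i _; rewrite coefXn mul0r.
Qed.

End Taylor.

(** * Matrix congruences modulo an element of a commutative ring *)

Section MatrixCongruence.
Variables (R : comNzRingType) (c : R).

Definition mxcong m n (A B : 'M[R]_(m, n)) : Prop := exists Q, A = B + c *: Q.

Lemma mxcong_entries m n (A B : 'M[R]_(m, n)) :
  (forall i j, exists h, A i j = B i j + c * h) -> mxcong A B.
Proof.
move=> eqAB; have /fin_all_exists[Q defQ] i := fin_all_exists (eqAB i).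
by exists (\matrix_(i, j) Q i j); apply/matrixP => i j; rewrite !mxE.
Qed.

Lemma mxcong_refl m n (A : 'M[R]_(m, n)) : mxcong A A.
Proof. by exists 0; rewrite scaler0 addr0. Qed.

Lemma mxcong_sym m n (A B : 'M[R]_(m, n)) : mxcong A B -> mxcong B A.
Proof. by case=> Q ->; exists (- Q); rewrite scalerN addrK. Qed.

Lemma mxcong_trans m n (B A C : 'M[R]_(m, n)) :
  mxcong A B -> mxcong B C -> mxcong A C.
Proof. by case=> Q -> [Q' ->]; exists (Q' + Q); rewrite scalerDr addrA. Qed.

Lemma mxcong_mul m n p (A A' : 'M[R]_(m, n)) (B B' : 'M[R]_(n, p)) :
  mxcong A A' -> mxcong B B' -> mxcong (A *m B) (A' *m B').
Proof.
case=> Q -> [Q' ->]; exists (A' *m Q' + Q *m (B' + c *: Q')).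
by rewrite mulmxDl mulmxDr -scalemxAr -scalemxAl scalerDr addrA.
Qed.

Lemma mxcong_sub m n (A A' B B' : 'M[R]_(m, n)) :
  mxcong A A' -> mxcong B B' -> mxcong (A - B) (A' - B').
Proof.
case=> Q -> [Q' ->]; exists (Q - Q').
by rewrite scalerBr opprD addrACA.
Qed.

Lemma mxcong_tr m n (A B : 'M[R]_(m, n)) : mxcong A B -> mxcong A^T B^T.
Proof. by case=> Q ->; exists Q^T; rewrite linearD linearZ. Qed.

Lemma mxcong_scale m n x (A B : 'M[R]_(m, n)) :
  mxcong A B -> mxcong (x *: A) (x *: B).
Proof. by case=> Q ->; exists (x *: Q); rewrite scalerDr !scalerA mulrC. Qed.

Definition unit_mod (x : R) : Prop := exists u w, u * x = 1 + c * w.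

(** With u inverse to [\det A] modulo c, the matrix [u *: \adj A] is a left inverse of A modulo
    c. *)
Lemma mxcong_mulI m n (A : 'M[R]_m) (B B' : 'M[R]_(m, n)) :
  unit_mod (\det A) -> mxcong (A *m B) (A *m B') -> mxcong B B'.
Proof.
case=> u [w def_u] eqAB.
have cancelA (C : 'M_(m, n)) : mxcong (u *: \adj A *m (A *m C)) C.
  exists (w *: C); rewrite mulmxA -scalemxAl mul_adj_mx -scalemxAl mul_scalar_mx.
  by rewrite !scalerA def_u scalerDl scale1r.
apply: mxcong_trans (cancelA B'); apply: mxcong_trans (mxcong_sym (cancelA B)) _.
by apply: mxcong_mul eqAB; apply: mxcong_refl.
Qed.

Lemma mxcong_mulIr m n (A : 'M[R]_m) (B B' : 'M[R]_(n, m)) :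
  unit_mod (\det A) -> mxcong (B *m A) (B' *m A) -> mxcong B B'.
Proof.
rewrite -det_tr => uA /mxcong_tr; rewrite !trmx_mul => /(mxcong_mulI uA)/mxcong_tr.
by rewrite !trmxK.
Qed.

(* If L = U V and S = U D V, then L^-1 S = V^-1 D V. *)
Lemma mxcong_adj_conj m (L S U V D : 'M[R]_m) :
    unit_mod (\det U) -> mxcong L (U *m V) -> mxcong S (U *m D *m V) ->
  mxcong (V *m (\adj L *m S)) (\det L *: (D *m V)).
Proof.
move=> uU eqL eqS; apply: (mxcong_mulI uU).
(* As U V is congruent to L, multiplying by U leaves L adj(L) S, which is det(L) S. *)
apply: (@mxcong_trans _ _ (L *m (\adj L *m S))).
  by rewrite mulmxA; apply: mxcong_mul (mxcong_sym eqL) (mxcong_refl _).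
rewrite mulmxA mul_mx_adj mul_scalar_mx -scalemxAr mulmxA.
exact: mxcong_scale.
Qed.

(** Both A B E and B A E are congruent to d^2 E DA DB, and E cancels. The scalar d allows for a
    denominator cleared from A and B. *)
Lemma mxcong_comm_of_eigen m (A B E DA DB : 'M[R]_m) d :
    unit_mod (\det E) -> DA *m DB = DB *m DA ->
    mxcong (A *m E) (d *: (E *m DA)) -> mxcong (B *m E) (d *: (E *m DB)) ->
  mxcong (A *m B - B *m A) 0.
Proof.
move=> uE comD eqA eqB; apply: (mxcong_mulIr uE).
have prod_eq (A' B' DA' DB' : 'M_m) :
    mxcong (A' *m E) (d *: (E *m DA')) -> mxcong (B' *m E) (d *: (E *m DB')) ->
  mxcong (A' *m B' *m E) ((d * d) *: (E *m (DA' *m DB'))).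
  move=> eqA' eqB'; rewrite -mulmxA.
  apply: mxcong_trans (mxcong_mul (mxcong_refl A') eqB') _.
  rewrite -scalemxAr -scalerA; apply: mxcong_scale.
  by rewrite !mulmxA scalemxAl; apply: mxcong_mul eqA' (mxcong_refl _).
rewrite mulmxBl mul0mx -(subrr ((d * d) *: (E *m (DA *m DB)))).
by apply: mxcong_sub; [|rewrite comD]; apply: prod_eq.
Qed.

End MatrixCongruence.

Lemma unit_mod_Xn (K : fieldType) r (q : {poly K}) : q.[0] != 0 -> unit_mod 'X^r q.
Proof.
move=> q0; have /Bezout_eq1_coprimepP[[u v] /= def1] : coprimep q 'X^r.
  by apply: coprimep_expr; rewrite coprimepX rootE.
by exists u, (- v); rewrite -def1 mulrN [_ * v]mulrC addrK.
Qed.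

(** * First-order expansions of polynomials and traces over clusters *)

Section LinearTaylor.
Variables (R : realType) (m : nat).
Implicit Types (g : {mpoly R[i][m]}) (u w : 'I_m -> R[i]).

Let pt u w : 'I_m -> {poly R[i]} := fun j => (u j)%:P + w j *: 'X.

(** Here a is g(u) and L the gradient of g at u; they are chosen before w, so all points of a
    cluster share them. Polynomials with such an expansion include constants and variables and are
    closed under sums and products. *)
Lemma eval_eps_linear g u : exists a (L : 'I_m -> R[i]), forall w,
  exists h, eval_eps g (pt u w) = a%:P + (\sum_j w j * L j) *: 'X + 'X^2 * h.
Proof.
pose lin g := exists a (L : 'I_m -> R[i]), forall w,
  exists h, eval_eps g (pt u w) = a%:P + (\sum_j w j * L j) *: 'X + 'X^2 * h.
rewrite -/(lin g).
have linC c : lin c%:MP.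
  exists c, (fun=> 0) => w; exists 0; rewrite /eval_eps mmapC big1 => [|j _].
    by rewrite scale0r mulr0 !addr0.
  by rewrite mulr0.
have linD g1 g2 : lin g1 -> lin g2 -> lin (g1 + g2).
  move=> [a1 [L1 eq1]] [a2 [L2 eq2]].
  exists (a1 + a2), (fun j => L1 j + L2 j) => w.
  have [[h1 e1] [h2 e2]] := (eq1 w, eq2 w); exists (h1 + h2).
  rewrite /eval_eps mmapD -/(eval_eps g1 _) -/(eval_eps g2 _) e1 e2.
  under [X in _ = _ + X *: _ + _]eq_bigr do rewrite mulrDr.
  by rewrite big_split /= polyCD scalerDl mulrDr [LHS]addrACA; congr (_ + _); rewrite addrACA.
have linM g1 g2 : lin g1 -> lin g2 -> lin (g1 * g2).
  move=> [a1 [L1 eq1]] [a2 [L2 eq2]].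
  exists (a1 * a2), (fun j => a1 * L2 j + a2 * L1 j) => w.
  have [[h1 e1] [h2 e2]] := (eq1 w, eq2 w).
  set s1 := \sum_j w j * L1 j in e1; set s2 := \sum_j w j * L2 j in e2.
  (* What the product of the two expansions leaves beyond its constant and linear terms, divided by
     ['X^2]. *)
  exists ((s1 * s2)%:P + (a1%:P + s1 *: 'X + 'X^2 * h1) * h2 +
          h1 * (a2%:P + s2 *: 'X)).
  rewrite /eval_eps rmorphM /= -/(eval_eps g1 _) -/(eval_eps g2 _) e1 e2.
  have -> : \sum_j w j * (a1 * L2 j + a2 * L1 j) = a1 * s2 + a2 * s1.
    rewrite !mulr_sumr -big_split; apply: eq_bigr => j _ /=.
    by rewrite mulrDr ![w j * (_ * _)]mulrCA.
  rewrite -!mul_polyC !(polyCD, polyCM) expr2.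
  ring.
have linX j : lin 'X_j.
  exists (u j), (fun i => (i == j)%:R) => w; exists 0.
  rewrite /eval_eps mmapX mmap1U mulr0 addr0 (bigD1 j) //= eqxx mulr1 big1 ?addr0 //.
  by move=> i /negPf->; rewrite mulr0.
elim/mpolyind: g => [|c mm p _ _ IHp]; first by rewrite -mpolyC0.
apply: linD IHp; rewrite -mul_mpolyC; apply: (linM) => //.
rewrite mpolyXE_id; elim/big_ind: _ => [|g1 g2|j _]; [by rewrite -mpolyC1 | exact: linM |].
by elim: (mm j) => [|e IHe]; rewrite ?expr0 -?mpolyC1 // exprS; apply: linM.
Qed.

Variables (k : nat) (ns : 'I_k -> nat).
Hypothesis ns_gt0 : forall s, (0 < ns s)%N.
Variable z : 'I_k -> 'I_m -> R[i].
Variable delta : forall s : 'I_k, 'I_(ns s) -> 'I_m -> R[i].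

Lemma Tr_xi g : exists h,
  Tr z delta g = \sum_s (ns s)%:R * eval_eps g (xi z delta s) + 'X^2 * h.
Proof.
suff /fin_all_exists[h def_h] (s : 'I_k) : exists h,
    \sum_(t < ns s) eval_eps g (cluster_point z delta t) =
    (ns s)%:R * eval_eps g (xi z delta s) + 'X^2 * h.
  exists (\sum_s h s); rewrite /Tr mulr_sumr -big_split /=.
  by apply: eq_bigr => s _; apply: def_h.
have [a [L eqL]] := eval_eps_linear g (z s).
have ns0 : (ns s)%:R != 0 :> R[i] by rewrite pnatr_eq0 -lt0n.
(* The barycentre is the point whose displacement w is the mean of the cluster's, so the same a and
   L serve. *)
have [h0 def0] : exists h0, eval_eps g (xi z delta s) =
    a%:P + (\sum_j (\sum_(r < ns s) delta r j) / (ns s)%:R * L j) *: 'X + 'X^2 * h0.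
  exact: eqL.
have /fin_all_exists[h def_h] (t : 'I_(ns s)) : exists h,
    eval_eps g (cluster_point z delta t) =
    a%:P + (\sum_j delta t j * L j) *: 'X + 'X^2 * h by apply: eqL.
exists (\sum_t h t - (ns s)%:R * h0).
rewrite def0.
under eq_bigr => t _ do rewrite def_h.
rewrite !big_split /= sumr_const card_ord -mulr_sumr -scaler_suml.
(* The linear terms of the cluster add up to n_s times that of the barycentre; n_s is invertible
   since the cluster is nonempty. *)
have -> : \sum_(t < ns s) \sum_j delta t j * L j =
    (ns s)%:R * (\sum_j (\sum_(r < ns s) delta r j) / (ns s)%:R * L j).
  rewrite exchange_big mulr_sumr; apply: eq_bigr => j _ /=.
  by rewrite mulrA mulrCA mulfV // mulr1 mulr_suml.
rewrite -[a%:P *+ _]mulr_natl -!mul_polyC polyCM polyC_natr.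
ring.
Qed.

End LinearTaylor.

(** * Matrices of rational functions over a common denominator *)

Section FractionMatrices.
Variable K : fieldType.
Implicit Types q : {poly K}.

(** With one denominator q, nonzero at 0, congruences of rational matrices reduce to [mxcong] on
    polynomial numerators. *)
Definition fracmx m n q (A : 'M[{poly K}]_(m, n)) : 'M[{fraction {poly K}}]_(m, n) :=
  q%:F^-1 *: map_mx (@FracField.tofrac _) A.

Lemma fracmx_has_taylor m n q (A : 'M_(m, n)) :
  q.[0] != 0 -> mx_has_taylor (fracmx q A).
Proof.
move=> q0 i j; exists (taylor q (A i j)); rewrite !mxE mulrC.
exact: taylor_has_taylor.
Qed.

Lemma fracmx_eqmod m n q (A B : 'M_(m, n)) :
  q.[0] != 0 -> mxcong 'X^2 A B -> mx_eqmod_eps2 (fracmx q A) (fracmx q B).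
Proof.
move=> q0 [Q ->] i j; rewrite !mxE ![q%:F^-1 * _]mulrC.
exact: (@eqmod_eps2_div _ _ _ _ (Q i j)).
Qed.

Lemma fracmx_mul m n p q1 q2 (A : 'M_(m, n)) (B : 'M_(n, p)) :
  fracmx q1 A *m fracmx q2 B = fracmx (q1 * q2) (A *m B).
Proof.
by rewrite /fracmx -scalemxAl -scalemxAr scalerA map_mxM rmorphM invfM.
Qed.

Lemma fracmx_sub m n q (A B : 'M_(m, n)) :
  fracmx q A - fracmx q B = fracmx q (A - B).
Proof. by rewrite /fracmx -scalerBr map_mxB. Qed.

Lemma fracmx1 m n (A : 'M_(m, n)) : map_mx (@FracField.tofrac _) A = fracmx 1 A.
Proof. by rewrite /fracmx rmorph1 invr1 scale1r. Qed.

Lemma fracmx0 m n q : fracmx q (0 : 'M_(m, n)) = 0.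
Proof. by rewrite /fracmx map_mx0 scaler0. Qed.

(** Puts a polynomial matrix over the denominator q, for comparison with another matrix over q. *)
Lemma fracmxZ m n q (A : 'M_(m, n)) :
  q != 0 -> fracmx q (q *: A) = map_mx (@FracField.tofrac _) A.
Proof.
by move=> q0; rewrite /fracmx map_mxZ scalerA mulVf ?scale1r // tofrac_eq0.
Qed.

Lemma fracmx_unit n (A : 'M[{poly K}]_n) :
  \det A != 0 -> map_mx (@FracField.tofrac _) A \in unitmx.
Proof. by move=> dA; rewrite unitmxE det_map_mx unitfE tofrac_eq0. Qed.

Lemma fracmx_inv n (A : 'M[{poly K}]_n) :
  \det A != 0 -> invmx (map_mx (@FracField.tofrac _) A) = fracmx (\det A) (\adj A).
Proof.
by move=> dA; rewrite /invmx fracmx_unit // det_map_mx /fracmx map_mx_adj.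
Qed.

Lemma mxcong_Xn_det0 n r (A B : 'M[{poly K}]_n) :
  mxcong 'X^(r.+1) A B -> (\det A).[0] = (\det B).[0].
Proof.
case=> Q ->; rewrite -!horner_evalE -!det_map_mx; congr (\det _).
apply/matrixP => i j.
by rewrite !mxE /= /horner_eval hornerD hornerM hornerXn expr0n mul0r addr0.
Qed.

End FractionMatrices.

(** * Factorisation through the barycentres and the common eigensystem *)

Lemma eval_epsM (R : realType) m (g h : {mpoly R[i][m]}) v :
  eval_eps (g * h) v = eval_eps g v * eval_eps h v.
Proof. exact: rmorphM. Qed.

Lemma eval_epsX (R : realType) m (j : 'I_m) (v : 'I_m -> {poly R[i]}) :
  eval_eps 'X_j v = v j.
Proof. by rewrite /eval_eps mmapX mmap1U. Qed.

Theorem corollary7p6 (R : realType) (m k n : nat)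
  (b : 'I_n -> {mpoly R[i][m]})
  (ns : 'I_k -> nat)
  (ns_gt0 : forall s : 'I_k, (0 < ns s)%N)
  (sum_ns : (\sum_(s < k) ns s)%N = n)
  (z : 'I_k -> 'I_m -> R[i])
  (delta : forall s : 'I_k, 'I_(ns s) -> 'I_m -> R[i])
  (delta_lt1 : forall (s : 'I_k) (t : 'I_(ns s)) (j : 'I_m),
     `|delta s t j| < 1)
  (sigma : 'S_n)
  (sigma_gecp : exists A : 'M[{fraction {poly R[i]}}]_n,
     gecp (map_mx (@FracField.tofrac _) (trace_mx z delta b)) k sigma 1%g A)
  (rank_PR0 :
     \rank (map_mx (horner_eval 0) (row_perm sigma (trace_mx z delta b))) = k)
  (regular_PR0 :
     regular_mx (map_mx (horner_eval 0) (row_perm sigma (trace_mx z delta b)))) :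
  let hkn := leq_clusters ns_gt0 sum_ns in
  let M' := approx_mult_mx z delta b hkn sigma in
  let e := e_xi z delta b hkn in
  [/\ (* the systems defining M' have a unique solution, with entries that
         have a Taylor expansion at eps = 0 *)
      lead_trace_mx z delta b hkn sigma \in unitmx
      /\ (forall j : 'I_m, mx_has_taylor (M' j)),
      forall (i : 'I_k) (j : 'I_m),
        mx_eqmod_eps2 (M' j *m e i) ((xi z delta i j)%:F *: e i),
      basis_mod_eps2 e
    & forall i j : 'I_m, mx_eqmod_eps2 (M' i *m M' j - M' j *m M' i) 0].

Proof.
move=> hkn M' e; pose idx := widen_ord hkn.
pose V : 'M[{poly R[i]}]_k := \matrix_(s, j) eval_eps (b (idx j)) (xi z delta s).
pose U : 'M[{poly R[i]}]_k :=
  \matrix_(l, s) ((ns s)%:R * eval_eps (b (sigma (idx l))) (xi z delta s)).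
pose D j : 'M[{poly R[i]}]_k := diag_mx (\row_s xi z delta s j).
pose L := mxsub idx idx (row_perm sigma (trace_mx z delta b)).
pose S j : 'M[{poly R[i]}]_k :=
  \matrix_(s, l) Tr z delta ('X_j * b (idx l) * b (sigma (idx s))).
have eqL : mxcong 'X^2 L (U *m V).
  apply: mxcong_entries => l t; rewrite !mxE.
  have [h ->] := Tr_xi ns_gt0 z delta (b (sigma (idx l)) * b (idx t)).
  exists h; congr (_ + _); apply: eq_bigr => s _.
  by rewrite !mxE eval_epsM mulrA.
have eqS j : mxcong 'X^2 (S j) (U *m D j *m V).
  apply: mxcong_entries => l t; rewrite -mulmxA mul_diag_mx !mxE.
  have [h ->] := Tr_xi ns_gt0 z delta ('X_j * b (idx t) * b (sigma (idx l))).
  exists h; congr (_ + _); apply: eq_bigr => s _.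
  by rewrite !mxE !eval_epsM eval_epsX [_ * eval_eps (b (sigma _)) _]mulrC !mulrA.
have detL0 : (\det L).[0] != 0.
  (* At 0 this determinant is the leading k x k minor of a regular matrix of rank k. *)
  rewrite -horner_evalE -det_map_mx map_mxsub.
  exact: regular_lead_det.
have /andP[detU0 detV0] : ((\det U).[0] != 0) && ((\det V).[0] != 0).
  by rewrite -negb_or -mulf_eq0 -hornerM -det_mulmx -(mxcong_Xn_det0 eqL).
have nz (p : {poly R[i]}) : p.[0] != 0 -> p != 0.
  by apply: contraNneq => ->; rewrite horner0.
(* The transpose appears because [approx_mult_mx] stores the solution vectors as rows. *)
pose A j := (\adj L *m S j)^T.
have defM j : M' j = fracmx (\det L) (A j).
  have eq_rhs : map_mx (@FracField.tofrac _) (S j) =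
      \matrix_(s, l) trace_rhs z delta b hkn sigma j l s ord0.
    by apply/matrixP => s l; rewrite !mxE.
  apply/matrixP => l s; rewrite /M' mxE /trace_sol /lead_trace_mx -/L.
  rewrite fracmx_inv ?nz // -[\det L]mulr1 /A.
  have -> : fracmx (\det L * 1) (\adj L *m S j)^T = (fracmx (\det L) (\adj L) *m
      \matrix_(s, l) trace_rhs z delta b hkn sigma j l s ord0)^T.
    by rewrite -eq_rhs fracmx1 fracmx_mul; apply/matrixP => ? ?; rewrite !mxE.
  by rewrite mulr1 !mxE; apply: eq_bigr => t _; rewrite !mxE.
have defe i : e i = map_mx (@FracField.tofrac _) (col i V^T).
  by apply/matrixP => s l; rewrite !mxE.
have eqA j : mxcong 'X^2 (A j *m V^T) (\det L *: (V^T *m D j)).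
  have /mxcong_tr := mxcong_adj_conj (unit_mod_Xn 2 detU0) eqL (eqS j).
  by rewrite trmx_mul linearZ /= [(D j *m V)^T]trmx_mul tr_diag_mx.
(* Only M'_j = A_j / det(L) and A_j V^T = det(L) V^T D_j modulo ['X^2] matter from here on. *)
move: A defM eqA => A defM eqA; split.
- split; first exact/fracmx_unit/nz.
  by move=> j; rewrite defM; apply: fracmx_has_taylor.
- move=> i j; rewrite defM defe fracmx1 fracmx_mul mulr1 -fracmx1.
  (* The eigenvalue side is put over det(L) too; the claim is then column i of the congruence for
     A_j. *)
  rewrite -map_mxZ -(fracmxZ _ (nz _ detL0)); apply: fracmx_eqmod => //.
  have -> : xi z delta i j *: col i V^T = col i (V^T *m D j).
    by apply/matrixP => s l; rewrite mul_mx_diag !mxE mulrC.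
  rewrite !colE mulmxA scalemxAl.
  exact: mxcong_mul (eqA j) (mxcong_refl _ _).
- have detVT : \det V^T != 0 by rewrite det_tr nz.
  have defE : \matrix_(s < k, i < k) e i s ord0 = map_mx (@FracField.tofrac _) V^T.
    by apply/matrixP => s i; rewrite !mxE.
  rewrite /basis_mod_eps2 defE.
  (* The exact inverse has denominator det(V), nonzero at 0, so it expands at 0 and both congruences
     are equalities. *)
  exists (invmx (map_mx (@FracField.tofrac _) V^T)); split.
  + by rewrite fracmx_inv //; apply: fracmx_has_taylor; rewrite det_tr.
  + rewrite mulmxV ?fracmx_unit // -(map_mx1 (@FracField.tofrac _)) fracmx1.
    by apply: fracmx_eqmod (mxcong_refl _ _); rewrite hornerC oner_neq0.
  + rewrite mulVmx ?fracmx_unit // -(map_mx1 (@FracField.tofrac _)) fracmx1.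
    by apply: fracmx_eqmod (mxcong_refl _ _); rewrite hornerC oner_neq0.
(* Both products have denominator det(L)^2; the numerators commute modulo ['X^2] because the
   diagonal matrices D_i and D_j do. *)
- move=> i j; rewrite (defM i) (defM j) (fracmx_mul _ _ (A i)) (fracmx_mul _ _ (A j)) fracmx_sub.
  rewrite -(fracmx0 k k (\det L * \det L)).
  apply: fracmx_eqmod; first by rewrite hornerM mulf_neq0.
  apply: (mxcong_comm_of_eigen _ _ (eqA i) (eqA j)).
    by apply: unit_mod_Xn; rewrite det_tr.
  by rewrite /D !mulmx_diag; congr diag_mx; apply/rowP => s; rewrite !mxE mulrC.
Qed.
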